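(* Let $n$ and $k$ be positive integers with $k\le n$, and let $m$ be a nonnegative integer. Consider an airplane with $n$ seats numbered $1,\dots,n$ and $n$ passengers numbered $1,\dots,n$, passenger $i$ being assigned seat $i$. Passengers board one at a time in the order $1,2,\dots,n$. Passengers $1,\dots,k$ are absent-minded: when it is such a passenger's turn, he chooses a seat uniformly at random among the currently unoccupied seats. Each passenger $i>k$ sits in seat $i$ if it is unoccupied, and otherwise chooses a seat uniformly at random among the currently unoccupied seats. Call a passenger misseated if he does not end up in his assigned seat. Then the probability $P_{n,k}(m)$ that exactly $m$ passengers are misseated is \[ P_{n,k}(m)=\frac{1}{n!}\sum_{s=0}^{k}\binom{k}{s}\sum_{t=0}^{s}(t!)^2\left\{{m-s \atop t}\right\}\left[{n-k+1 \atop m-s+1}\right]\sum_{r=t}^{s}\binom{s}{r}L(r,t)\,d_{s-r}. \]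
   Context: Notation: $\left[{i \atop j}\right]$ is the unsigned Stirling number of the first kind (number of permutations of $i$ elements with exactly $j$ disjoint cycles); $\left\{{i \atop j}\right\}$ is the Stirling number of the second kind (number of partitions of a set of $i$ labeled objects into $j$ nonempty unlabeled blocks); $L(i,j)$ is the Lah number (number of ways to partition a set of $i$ elements into $j$ nonempty linearly ordered subsets, with $L(0,0)=1$); $d_i$ is the number of derangements (fixed-point-free permutations) of an $i$-element set, with $d_0=1$. Conventions for positive integers $p,q$: $\left\{{-p \atop q}\right\}=0$, $\left\{{-p \atop 0}\right\}=0$, $\left\{{0 \atop q}\right\}=0$, $\left\{{0 \atop 0}\right\}=1$, $\left[{p \atop 0}\right]=0$, $\left[{p \atop -q}\right]=0$. *)

(* Defs.v *)
From mathcomp Require Import all_boot all_order all_algebra.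
Set Implicit Arguments. Unset Strict Implicit. Unset Printing Implicit Defensive.
Import Order.TTheory GRing.Theory Num.Theory.

Fixpoint stirling1 (i j : nat) : nat :=
  match i, j with
  | 0, 0 => 1
  | 0, _.+1 => 0
  | _.+1, 0 => 0
  | i'.+1, j'.+1 => i' * stirling1 i' j'.+1 + stirling1 i' j'
  end.

Fixpoint stirling2 (i j : nat) : nat :=
  match i, j with
  | 0, 0 => 1
  | 0, _.+1 => 0
  | _.+1, 0 => 0
  | i'.+1, j'.+1 => j'.+1 * stirling2 i' j'.+1 + stirling2 i' j'
  end.

Fixpoint lah (i j : nat) : nat :=
  match i, j with
  | 0, 0 => 1
  | 0, _.+1 => 0
  | _.+1, 0 => 0
  | i'.+1, j'.+1 => (i' + j'.+1) * lah i' j'.+1 + lah i' j'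
  end.

Fixpoint derange (i : nat) : nat :=
  match i with
  | 0 => 1
  | 1 => 0
  | (i'.+1 as i1).+1 => i1 * (derange i1 + derange i')
  end.

Local Open Scope ring_scope.

(* The boarding process.  [board n k r occ c m] is the probability that,
   with [r] passengers still to board (the next one being passenger
   [n - r + 1]), seats [occ] already occupied and [c] passengers already
   misseated, exactly [m] passengers end up misseated. *)
Fixpoint board (n k r : nat) (occ : seq nat) (c m : nat) : rat :=
  match r with
  | 0 => if c == m then 1 else 0
  | r'.+1 =>
      let i := (n - r')%N in
      let free := [seq j <- iota 1 n | j \notin occ] in
      if (i <= k)%N || (i \in occ) then
        \sum_(j <- free)
           (size free)%:R^-1 * board n k r' (j :: occ) (c + (j != i))%N m
      else board n k r' (i :: occ) c m
  end.

Definition P_misseated (n k m : nat) : rat := board n k n [::] 0 m.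

(* Main.v *)
Require Import Defs.
From mathcomp Require Import all_boot all_order all_algebra.
From mathcomp Require Import zify ring.
Import GRing.Theory Num.Theory.

(** Encode the situation before a passenger boards by the list of flags telling
which of the seats of the passengers still to board are occupied: the number of
true flags is also the number of free seats whose owner has already boarded.
Let [boardp] be [r!] times the generating function of the number of
misseatings among the [r] remaining passengers.  It depends on the positions
of the flags, but its sum over all flag lists of given length and number of
true flags satisfies closed recurrences.

For the passengers [i > k], the sum [A(N, b)] over lists of length [N] with [b]
true flags satisfies [A(N+1, b) = (N+1) A(N, b) + x b (A(N, b) + A(N, b-1))],
whence its coefficients [b! S2(m, b) S1(N+1, m+1)].  An absent-minded passenger
acts on the sums [g(u, j)], over lists with [u] true flags among the seats
up to [k] and [j] among the others, by [(1 - x) + x E], where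
[E = Y^2 d/dY + Y W d/dW + Y] with [Y = 1 + y] and [W = 1 + w] on the generating
functions [sum g(u, j) y^u w^j].  Hence [E^r] can be computed explicitly, and
[((1 - x) + x E)^k] is a mean of [E^r] against the binomial law.  At [u = j = 0]
this produces [r! C(r, t)], which is
[sum_s C(r, s) t! sum_i C(s, i) L(i, t) d_(s-i)], and the binomial mean of
[C(r, s)] is [C(k, s) x^s]. *)

(** * Binomial sums of derangement and Lah numbers *)

Lemma sum_binSl n (F : nat -> nat) M : n < M ->
  \sum_(q < M.+1) 'C(n.+1, q) * F q = \sum_(q < M) 'C(n, q) * (F q + F q.+1).
Proof.
move=> ltnM; under [RHS]eq_bigr => q _ do rewrite mulnDr.
rewrite big_split /= big_ord_recl /= bin0.
under eq_bigr => q _ do rewrite /bump /= add1n binS mulnDl.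
rewrite big_split /= addnA; congr (_ + _).
have -> : \sum_(q < M) 'C(n, q) * F q = \sum_(q < M.+1) 'C(n, q) * F q.
  by rewrite [RHS]big_ord_recr /= bin_small ?mul0n ?addn0.
by rewrite [RHS]big_ord_recl /= bin0.
Qed.

(** Permutations are sorted by the set of points they move; the induction follows the two-step
    recurrence of [derange]. *)
Lemma sum_bin_derange n M : n < M -> \sum_(q < M) 'C(n, q) * derange q = n`!.
Proof.
elim: n M => [|[|n] IHn] M ltnM.
- by case: M ltnM => // M _; rewrite big_ord_recl big1 //= => q _; rewrite bin0n.
- case: M ltnM => [|[|M]] // _.
  by rewrite !big_ord_recl big1 //= => q _; rewrite bin_small.
- case: M ltnM => // M ltnM.
  rewrite sum_binSl //; under eq_bigr => q _ do rewrite mulnDr.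
  rewrite big_split /= IHn // (factS n.+1) mulSn; congr (_ + _).
  rewrite -(IHn M.+1) ?ltnS 1?ltnW // sum_binSl ?ltnS 1?ltnW // big_distrr /=.
  case: M ltnM => // M ltnM; rewrite [LHS]big_ord_recl /= muln0 add0n.
  rewrite [RHS]big_ord_recr /= (@bin_small n) // mul0n muln0 addn0.
  apply: eq_bigr => q _; rewrite /bump /= add1n.
  by rewrite mulnA [RHS]mulnA mul_bin_diag; ring.
Qed.

Lemma lah_small i j : i < j -> lah i j = 0.
Proof.
elim: i j => [|i IHi] [|j] //= ltij.
by rewrite !IHi ?muln0 // ltnW.
Qed.

Lemma lah_fact i j : j.+1`! * lah i.+1 j.+1 = i.+1`! * 'C(i, j).
Proof.
elim: i j => [|i IHi] j.
  by case: j => [|j] //=; rewrite !muln0.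
have -> : lah i.+2 j.+1 = (i.+1 + j.+1) * lah i.+1 j.+1 + lah i.+1 j by [].
rewrite mulnDr mulnCA IHi.
case: j => [|j].
  by rewrite !bin0 [in RHS]factS [lah _ 0]/= muln0; ring.
rewrite (factS j.+1) -mulnA IHi binS [in RHS](factS i.+1).
have key : j.+1 * 'C(i, j.+1) + j * 'C(i, j) = i * 'C(i, j).
  rewrite mul_bin_left -mulnDl; have [/subnK->//|ltij] := leqP j i.
  by rewrite bin_small ?muln0.
transitivity (i.+1`! * (i.+2 * 'C(i, j.+1) + 2 * 'C(i, j) +
    (j.+1 * 'C(i, j.+1) + j * 'C(i, j)))); first ring.
rewrite key; ring.
Qed.

Lemma sum_bin_hockey n t : \sum_(r < n) 'C(r, t) = 'C(n, t.+1).
Proof.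
by elim: n => [|n IHn]; rewrite ?big_ord0 // big_ord_recr /= IHn binS.
Qed.

(** For [t > 0], [lah_fact] turns the term with [1 <= r <= n] into [n! 'C(r - 1, t - 1)], and the
    hockey-stick identity applies. *)
Lemma sum_lah_fact n t M : n < M ->
  \sum_(r < M) 'C(n, r) * (t`! * lah r t * (n - r)`!) = n`! * 'C(n, t).
Proof.
case: M => // M; rewrite ltnS => lenM.
rewrite big_ord_recl; case: t => [|t].
  rewrite big1 => [|r _]; last by rewrite /= mul0n muln0.
  by rewrite !bin0 subn0 addn0 [lah _ _]/= fact0 !mul1n muln1.
rewrite [lah ord0 _]/= !muln0 add0n -sum_bin_hockey.
rewrite (big_ord_widen _ (fun r => 'C(r, t)) lenM).
rewrite big_distrr [RHS]big_mkcond; apply: eq_bigr => r _.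
rewrite lift0; case: ltnP => [ltrn|lenr]; last first.
  by rewrite bin_small ?muln0.
by rewrite lah_fact -(bin_fact ltrn) /=; ring.
Qed.

(* For a fixed set T of t elements, the number of fixed-point-free injections of
   an s-set S into the disjoint union of S and T whose image contains T: r of the
   elements lie on t chains ending in T, and the s - r others form cycles. *)
Definition moved_injections s t :=
  t`! * \sum_(r < s.+1) 'C(s, r) * lah r t * derange (s - r).

Lemma bin_trinomial n s r : r <= s -> 'C(n, s) * 'C(s, r) = 'C(n, r) * 'C(n - r, s - r).
Proof.
move=> lers; have [lesn|ltns] := leqP s n; last first.
  rewrite bin_small // mul0n; case: (leqP r n) => [lern|ltnr].
    by rewrite [X in _ * X]bin_small ?muln0 // ltn_sub2r // (leq_ltn_trans lern ltns).
  by rewrite bin_small.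
apply/eqP; rewrite -(eqn_pmul2r (fact_gt0 r)) -(eqn_pmul2r (fact_gt0 (s - r)))
  -(eqn_pmul2r (fact_gt0 (n - s))).
have := bin_fact lesn; have := bin_fact lers; have := bin_fact (leq_trans lers lesn).
have := bin_fact (leq_sub2r r lesn); rewrite subnBA // subnK ?(leq_trans lers) //.
move=> E1 E2 E3 E4.
apply/eqP; transitivity (n`!).
  by rewrite -E4 -E3; ring.
by rewrite -E2 -E1; ring.
Qed.

(** Both sides count the injections of an n-set into its disjoint union with T whose image contains
    T; the left side sorts them by the set of moved points. *)
Lemma sum_bin_moved_injections n t :
  \sum_(s < n.+1) 'C(n, s) * moved_injections s t = n`! * 'C(n, t).
Proof.
rewrite -(@sum_lah_fact n t n.+1) //.
transitivity (\sum_(s < n.+1) \sum_(r < n.+1 | r <= s)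
   'C(n, s) * 'C(s, r) * (t`! * lah r t * derange (s - r))).
  apply: eq_bigr => s _; rewrite /moved_injections.
  rewrite (big_ord_widen n.+1 (fun r => 'C(s, r) * lah r t * derange (s - r))) //.
  by rewrite !big_distrr; apply: eq_bigr => r _ /=; ring.
rewrite (exchange_big_dep predT) //=; apply: eq_bigr => r _.
rewrite -(@sum_bin_derange (n - r) (n.+1 - r)) ?subSn ?leq_ord //; last first.
rewrite !big_distrr /=.
transitivity (\sum_(r <= s < n.+1) 'C(n, r) * 'C(n - r, s - r) *
    (t`! * lah r t * derange (s - r))).
  rewrite big_geq_mkord /=; apply: eq_bigr => s lers; by rewrite bin_trinomial.
rewrite -{1}[val r]add0n big_addn big_mkord subSn ?leq_ord //.
by apply: eq_bigr => s _; rewrite addnK; ring.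
Qed.

Local Open Scope ring_scope.

(** * Sums over flag lists *)

Fixpoint sum_bits (N c : nat) (F : seq bool -> {poly rat}) : {poly rat} :=
  match N with
  | 0 => if c == 0%N then F [::] else 0
  | N'.+1 => sum_bits N' c (fun v => F (false :: v)) +
      (if c is c'.+1 then sum_bits N' c' (fun v => F (true :: v)) else 0)
  end.

(* Sum of F over the lists obtained from v by turning one false flag into true. *)
Fixpoint sum_raise (F : seq bool -> {poly rat}) (v : seq bool) : {poly rat} :=
  if v is b :: v' then
    (if b then 0 else F (true :: v')) + sum_raise (fun w => F (b :: w)) v'
  else 0.

(** [K] counts the absent-minded passengers still to board. The scaling by [r!] cancels the
    probability 1/r of each choice, so only a passenger who makes no choice contributes a factor
    [r]. *)
Fixpoint boardp (r K : nat) (v : seq bool) : {poly rat} :=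
  if r is r'.+1 then
    let b := head false v in
    let v' := behead v in
    if (0 < K)%N || b then
      (if b then 0 else boardp r' K.-1 v') +
      'X * ((count id v)%:R * boardp r' K.-1 v' +
            sum_raise (boardp r' K.-1) v')
    else r%:R * boardp r' K.-1 v'
  else 1.

Lemma eq_sum_bits N c F G :
  (forall v, size v = N -> count id v = c -> F v = G v) ->
  sum_bits N c F = sum_bits N c G.
Proof.
elim: N c F G => [|N IHN] c F G eqFG /=.
  by case: eqP => // c0; apply: eqFG.
congr (_ + _); first by apply: IHN => v sv cv; apply: eqFG; rewrite /= ?sv.
by case: c eqFG => // c eqFG; apply: IHN => v sv cv; apply: eqFG; rewrite /= ?sv ?cv.
Qed.

Lemma sum_bitsD N c F G :
  sum_bits N c (fun v => F v + G v) = sum_bits N c F + sum_bits N c G.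
Proof.
elim: N c F G => [|N IHN] c F G /=; first by case: ifP; rewrite ?addr0.
by rewrite IHN; case: c => [|c]; rewrite ?IHN ?addr0 // addrACA.
Qed.

Lemma sum_bitsZ N c a F :
  sum_bits N c (fun v => a * F v) = a * sum_bits N c F.
Proof.
elim: N c F => [|N IHN] c F /=; first by case: ifP; rewrite ?mulr0.
by rewrite IHN; case: c => [|c]; rewrite ?IHN ?addr0 // mulrDr.
Qed.

Lemma sum_bits_gt N c F : (N < c)%N -> sum_bits N c F = 0.
Proof.
elim: N c F => [|N IHN] [|c] F //= ltNc.
by rewrite !IHN ?addr0 // ltnW.
Qed.

Lemma sum_raise_cat F u v :
  sum_raise F (u ++ v) =
  sum_raise (fun u' => F (u' ++ v)) u + sum_raise (fun v' => F (u ++ v')) v.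
Proof. by elim: u F => [|b u IHu] F /=; rewrite ?add0r // IHu addrA. Qed.

(* Each list with c.+1 true flags arises from c.+1 pairs (list, raised flag). *)
Lemma sum_bits_raise N c F :
  sum_bits N c (sum_raise F) = c.+1%:R * sum_bits N c.+1 F.
Proof.
elim: N c F => [|N IHN] c F /=; first by case: ifP; rewrite mulr0.
rewrite sum_bitsD IHN; case: c => [|c].
  by rewrite !mul1r addr0 addrC.
rewrite (eq_sum_bits N c _ (sum_raise (fun w => F (true :: w)))) => [|v _ _].
  by rewrite IHN [in RHS]mulrDr [c.+2%:R in X in _ = _ + X]mulrSr; ring.
by rewrite add0r.
Qed.

Lemma sum_bits_sum_raise N c (F : seq bool -> seq bool -> {poly rat}) u :
  sum_bits N c (fun v => sum_raise (F v) u) =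
  sum_raise (fun u' => sum_bits N c (F^~ u')) u.
Proof.
elim: u F => [|b u IHu] F /=; first by rewrite -(mul0r 0) sum_bitsZ !mul0r.
by rewrite sum_bitsD IHu; case: b; rewrite // -(mul0r 0) sum_bitsZ !mul0r.
Qed.

(** * Ordinary passengers and Stirling numbers *)

Definition tail_sum N b := sum_bits N b (boardp N 0).

Lemma tail_sum_rec N b :
  tail_sum N.+1 b = N.+1%:R * tail_sum N b +
    'X * (b%:R * (tail_sum N b + tail_sum N b.-1)).
Proof.
rewrite /tail_sum /= sum_bitsZ; congr (_ + _).
case: b => [|b]; first by rewrite mul0r mulr0.
transitivity (sum_bits N b (fun v =>
    'X * (b.+1%:R * boardp N 0 v + sum_raise (boardp N 0) v))).
  by apply: eq_sum_bits => v _ cv; rewrite add0r cv.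
by rewrite sum_bitsZ sum_bitsD sum_bitsZ sum_bits_raise /=; ring.
Qed.

(** The factor [b (A(N, b) + A(N, b-1))] reproduces the recurrence of [stirling2]; what remains is
    that of [stirling1]. *)
Lemma coef_tail_sum N b m :
  (tail_sum N b)`_m = (b`! * (stirling2 m b * stirling1 N.+1 m.+1))%:R.
Proof.
elim: N b m => [|N IHN] b m.
  rewrite /tail_sum /=; case: b => [|b]; case: m => [|m] //=.
  - by rewrite coefC.
  - by rewrite coefC.
  - by rewrite coef0 !mul0n muln0.
  - by rewrite coef0 addn0 !muln0.
rewrite tail_sum_rec coefD mulr_natl coefMn coefXM mulr_natl IHN.
case: m => [|m] /=.
  by rewrite addr0 -mulrnA; congr (_%:R); ring.
rewrite coefMn coefD !IHN; case: b => [|b] /=.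
  by rewrite !mul0n !muln0 mul0rn add0r.
rewrite -mulrnA -natrD -mulrnA -natrD factS; congr (_%:R); ring.
Qed.

(** * From the boarding process to flag lists *)

Lemma sum_raise_mem (s occ : seq nat) (F : seq bool -> {poly rat}) : uniq s ->
  \sum_(j <- s | j \notin occ) F [seq l \in j :: occ | l <- s] =
  sum_raise F [seq l \in occ | l <- s].
Proof.
elim: s F => [|a s IHs] F /=; first by rewrite big_nil.
move=> /andP[aNs us]; rewrite big_cons -IHs // mem_head.
have -> : \sum_(j <- s | j \notin occ)
    F ((a \in j :: occ) :: [seq l \in j :: occ | l <- s]) =
  \sum_(j <- s | j \notin occ) F ((a \in occ) :: [seq l \in j :: occ | l <- s]).
  rewrite big_seq_cond [RHS]big_seq_cond; apply: eq_bigr => j /andP[js _].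
  by rewrite inE; case: eqP => // eaj; rewrite eaj js in aNs.
have -> : [seq l \in a :: occ | l <- s] = [seq l \in occ | l <- s].
  apply/eq_in_map => l ls; rewrite inE.
  by case: eqP => // ela; rewrite -ela ls in aNs.
by case: (a \in occ); rewrite ?add0r.
Qed.

(** Seats of boarded passengers matter only through how many are free, a number that the flags
    determine. *)
Lemma board_boardp n k r occ c m :
  (r <= n)%N -> uniq occ -> {subset occ <= iota 1 n} -> size occ = (n - r)%N ->
  (r`!)%:R * board n k r occ c m =
  ('X^c * boardp r (k - (n - r)) [seq j \in occ | j <- iota (n - r).+1 r])`_m.
Proof.
elim: r occ c => [|r IHr] occ c lern uocc socc szocc.
  by rewrite /= mul1r mulr1 coefXn eq_sym; case: eqP.
set i := (n - r)%N.
have i_gt0 : (0 < i)%N by rewrite subn_gt0.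
have eni : (n - r.+1)%N = i.-1 by rewrite subnS.
rewrite eni in szocc *; rewrite prednK //.
have iotaE : iota 1 n = iota 1 i.-1 ++ i :: iota i.+1 r.
  have -> : i :: iota i.+1 r = iota i r.+1 by [].
  by rewrite -[in X in _ ++ iota X _](prednK i_gt0) -add1n -iotaD; congr iota; lia.
have bitsU j : (j <= i)%N ->
    [seq l \in j :: occ | l <- iota i.+1 r] = [seq l \in occ | l <- iota i.+1 r].
  move=> leji; apply/eq_in_map => l; rewrite mem_iota inE => /andP[ltil _].
  by rewrite gtn_eqF // (leq_ltn_trans leji).
have IH j c' : j \in iota 1 n -> j \notin occ ->
    (r`!)%:R * board n k r (j :: occ) c' m =
    ('X^c' * boardp r (k - i) [seq l \in j :: occ | l <- iota i.+1 r])`_m.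
  move=> jn jocc; apply: IHr => //=; first exact: ltnW.
  - by rewrite jocc.
  - by move=> l; rewrite inE => /predU1P[->|/socc].
  - by rewrite szocc prednK.
have count_occ : count (mem occ) (iota 1 n) = i.-1.
  rewrite -szocc -size_filter; apply/perm_size/uniq_perm => //.
    exact/filter_uniq/iota_uniq.
  by move=> l; rewrite mem_filter /= andb_idr //; apply: socc.
have in_i : i \in iota 1 n by rewrite iotaE mem_cat mem_head orbT.
rewrite [board _ _ _ _ _ _]/= -/i [boardp _ _ _]/=.
have -> : (0 < k - i.-1)%N = (i <= k)%N by rewrite subn_gt0 prednK.
have -> : (k - i.-1).-1 = (k - i)%N by lia.
case: ifPn => [_|]; last first.
  rewrite negb_or => /andP[_ iocc].
  by rewrite factS natrM -mulrA IH // bitsU // [in RHS]mulrCA [in RHS]mulr_natl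
    coefMn mulr_natl.
set free := [seq j <- _ | _].
have szfree : size free = r.+1.
  rewrite size_filter; have := count_predC (mem occ) (iota 1 n).
  rewrite count_occ size_iota => E; rewrite (eq_count (a2 := predC (mem occ))) //.
  by move: E; lia.
transitivity (\sum_(j <- free)
    ('X^(c + (j != i)) * boardp r (k - i) [seq l \in j :: occ | l <- iota i.+1 r])`_m).
  rewrite big_distrr /= big_seq [RHS]big_seq; apply: eq_bigr => j.
  rewrite mem_filter => /andP[jocc jn]; rewrite -IH // szfree factS natrM.
  by rewrite mulrACA mulfV ?mul1r // pnatr_eq0.
rewrite -coef_sum big_filter iotaE big_cat big_cons /=; congr ((polyseq _)`_m).
rewrite -(sum_raise_mem _ _ _ (iota_uniq _ _)).
set B := boardp r (k - i) [seq l \in occ | l <- iota i.+1 r].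
have -> : \sum_(j <- iota 1 i.-1 | j \notin occ)
    'X^(c + (j != i)) * boardp r (k - i) [seq l \in j :: occ | l <- iota i.+1 r] =
    'X^c * ('X * ((count id [seq l \in occ | l <- i :: iota i.+1 r])%:R * B)).
  transitivity (\sum_(j <- iota 1 i.-1 | j \notin occ) 'X^c * ('X * B)).
    rewrite big_seq_cond [RHS]big_seq_cond; apply: eq_bigr => j.
    rewrite mem_iota => /andP[lj _]; have ltji : (j < i)%N by lia.
    by rewrite bitsU ?(ltnW ltji) // neq_ltn ltji addn1 exprSr -mulrA.
  rewrite big_const_seq iter_addr_0 count_map.
  (* As many seats are occupied as passengers have boarded; removing the occupied seats of boarded
     passengers from both sets leaves equal numbers. *)
  have -> : count (fun j => j \notin occ) (iota 1 i.-1) =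
            count (preim (mem occ) id) (i :: iota i.+1 r).
    have := count_predC (mem occ) (iota 1 i.-1).
    by rewrite size_iota -[in RHS]count_occ iotaE count_cat => /addnI.
  by rewrite -mulr_natl; ring.
have -> : \sum_(j <- iota i.+1 r | j \notin occ)
    'X^(c + (j != i)) * boardp r (k - i) [seq l \in j :: occ | l <- iota i.+1 r] =
    'X^c * ('X * \sum_(j <- iota i.+1 r | j \notin occ)
       boardp r (k - i) [seq l \in j :: occ | l <- iota i.+1 r]).
  rewrite mulrA -exprSr big_distrr /= big_seq_cond [RHS]big_seq_cond.
  apply: eq_bigr => j; rewrite mem_iota => /andP[/andP[ltij _] _].
  by rewrite neq_ltn ltij orbT addn1.
rewrite bitsU // eqxx addn0 -/B [count _ (_ :: _)]/=; case: (i \in occ) => /=; ring.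
Qed.

(** * Binomial means *)

(* The mean of h r for r following the formal binomial law of parameters k, 'X. *)
Fixpoint binomial_mean (k : nat) (h : nat -> {poly rat}) : {poly rat} :=
  if k is k'.+1 then
    (1 - 'X) * binomial_mean k' h + 'X * binomial_mean k' (fun r => h r.+1)
  else h 0%N.

Lemma eq_binomial_mean k h h' : (forall r, (r <= k)%N -> h r = h' r) ->
  binomial_mean k h = binomial_mean k h'.
Proof.
elim: k h h' => [|k IHk] h h' eqh /=; first exact: eqh.
by congr (_ * _ + _ * _); apply: IHk => r lerk; apply: eqh; rewrite ?ltnS // leqW.
Qed.

Lemma binomial_meanD k h h' :
  binomial_mean k (fun r => h r + h' r) = binomial_mean k h + binomial_mean k h'.
Proof. by elim: k h h' => [|k IHk] h h' //=; rewrite !IHk; ring. Qed.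

Lemma binomial_meanZ k a h :
  binomial_mean k (fun r => a * h r) = a * binomial_mean k h.
Proof. by elim: k h => [|k IHk] h //=; rewrite !IHk; ring. Qed.

Lemma binomial_mean_sum k p (h : nat -> nat -> {poly rat}) :
  binomial_mean k (fun r => \sum_(s < p) h s r) =
  \sum_(s < p) binomial_mean k (h s).
Proof.
elim: p => [|p IHp].
  rewrite big_ord0 -[RHS](mul0r (binomial_mean k (fun=> 0))) -binomial_meanZ.
  by apply: eq_binomial_mean => r _; rewrite big_ord0 mul0r.
rewrite big_ord_recr /= -IHp -binomial_meanD.
by apply: eq_binomial_mean => r _; rewrite big_ord_recr.
Qed.

Lemma binomial_mean_bin k s :
  binomial_mean k (fun r => 'C(r, s)%:R) = 'C(k, s)%:R * 'X^s.
Proof.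
elim: k s => [|k IHk] s /=.
  by case: s => [|s]; rewrite ?expr0 ?mulr1 // mul0r.
rewrite IHk; case: s => [|s].
  rewrite (eq_binomial_mean _ _ (fun r => 'C(r, 0)%:R)) ?IHk ?bin0; first ring.
  by move=> r _; rewrite !bin0.
rewrite (eq_binomial_mean _ _ (fun r => 'C(r, s.+1)%:R + 'C(r, s)%:R)).
  by rewrite binomial_meanD !IHk binS natrD !exprS; ring.
by move=> r _; rewrite binS natrD.
Qed.

(** * Absent-minded passengers *)

Definition prefix_sum N K u j : {poly rat} :=
  sum_bits K u (fun U => sum_bits N j (fun T => boardp (K + N) K (U ++ T))).

(** The chosen seat belongs to a boarded passenger, to a later absent-minded one, or to an ordinary
    one. *)
Definition occupy (g : nat -> nat -> {poly rat}) (a u j : nat) : {poly rat} :=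
  a%:R * g u j + u.+1%:R * g u.+1 j + j.+1%:R * g u j.+1.

(* The operator E of the header; its identity part accounts for the -1 in
   (1 - 'X) + 'X * E = 1 + 'X * (E - 1). *)
Definition random_step (g : nat -> nat -> {poly rat}) (u j : nat) : {poly rat} :=
  occupy g (u + j).+1 u j + (if u is u'.+1 then occupy g (u + j) u' j else 0).

Lemma sum_bits_occupy N K (F : seq bool -> {poly rat}) a u j :
  sum_bits K u (fun U => sum_bits N j (fun T =>
    a%:R * F (U ++ T) + sum_raise F (U ++ T))) =
  occupy (fun u' j' => sum_bits K u' (fun U => sum_bits N j' (fun T => F (U ++ T))))
    a u j.
Proof.
rewrite /occupy -addrA -sum_bits_raise -2!sum_bitsZ -!sum_bitsD.
apply: eq_sum_bits => U _ _; rewrite -sum_bits_raise -sum_bits_sum_raise.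
rewrite -sum_bitsZ -!sum_bitsD; apply: eq_sum_bits => T _ _.
by rewrite sum_raise_cat.
Qed.

Lemma prefix_sum_rec N K u j :
  prefix_sum N K.+1 u j =
  (1 - 'X) * prefix_sum N K u j + 'X * random_step (prefix_sum N K) u j.
Proof.
transitivity (prefix_sum N K u j + 'X * occupy (prefix_sum N K) (u + j) u j +
    'X * (if u is u'.+1 then occupy (prefix_sum N K) (u + j) u' j else 0)); last first.
  have -> g : random_step g u j = g u j + occupy g (u + j) u j +
      (if u is u'.+1 then occupy g (u + j) u' j else 0).
    by rewrite /random_step /occupy -natr1; ring.
  by rewrite mulrBl mul1r 2![in RHS]mulrDr !addrA subrK.
rewrite {1}/prefix_sum [sum_bits K.+1 _ _]/=; congr (_ + _).
  rewrite -sum_bits_occupy -sum_bitsZ -sum_bitsD.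
  apply: eq_sum_bits => U _ cU; rewrite -sum_bitsZ -sum_bitsD.
  by apply: eq_sum_bits => T _ cT; rewrite count_cat cU cT.
case: u => [|u]; first by rewrite mulr0.
rewrite -sum_bits_occupy -sum_bitsZ.
apply: eq_sum_bits => U _ cU; rewrite -sum_bitsZ.
by apply: eq_sum_bits => T _ cT; rewrite count_cat cU cT add0r.
Qed.

(* E^r applied to the generating function of f: the coefficient of w^j y^u is
   'C(r, u) times this value, for M beyond the support of f. *)
Definition chain_sum (f : nat -> {poly rat}) M r j : {poly rat} :=
  r`!%:R * \sum_(t < M) ('C(t, j) * 'C(r + j, t))%:R * f t.

Lemma chain_sum0 f M j : chain_sum f M 0 j = if (j < M)%N then f j else 0.
Proof.
rewrite /chain_sum mul1r; case: ltnP => [ltjM|leMj].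
  rewrite (bigD1 (Ordinal ltjM)) //= !binn mul1r big1 ?addr0 // => t neq_tj.
  have [ltjt|] := ltnP j t; first by rewrite (@bin_small j) // muln0 mul0r.
  rewrite leq_eqVlt => /orP[/eqP etj|ltjt]; last by rewrite bin_small // mul0r.
  by case/eqP: neq_tj; apply: val_inj.
by rewrite big1 // => t _; rewrite bin_small ?mul0r // (leq_trans (ltn_ord t)).
Qed.

Lemma chain_sumS f M r j :
  chain_sum f M r.+1 j =
  (r + j).+1%:R * chain_sum f M r j + j.+1%:R * chain_sum f M r j.+1.
Proof.
rewrite /chain_sum factS natrM -mulrA mulrCA [X in _ = X + _]mulrCA.
rewrite [X in _ = _ + X]mulrCA -mulrDr; congr (_ * _).
rewrite !big_distrr -big_split; apply: eq_bigr => t _ /=.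
rewrite !mulrA -!natrM -mulrDl -natrD; congr (_%:R * _).
rewrite addSn addnS [(j.+1 * _)%N]mulnA (mul_bin_left t j).
have [ltj|lej] := ltnP t j; first by rewrite (bin_small ltj) !(muln0, mul0n).
have [letr|ltrt] := leqP t (r + j).+1; last first.
  by rewrite !(@bin_small _ t) ?muln0 // ltnW.
transitivity ('C(t, j) * ((r + j).+1 * 'C((r + j).+1.-1, t)) +
    (t - j) * 'C(t, j) * 'C((r + j).+1, t))%N; last by rewrite /=; ring.
have -> : r.+1 = ((r + j).+1 - t + (t - j))%N by lia.
by rewrite mul_bin_down; ring.
Qed.

(** Since [(u+1) 'C(r, u+1) = (r - u) 'C(r, u)], both parts of the step acquire the same factor,
    free of [u]; Pascal's rule then adds them. *)
Lemma random_step_chain f M r u j :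
  random_step (fun u j => 'C(r, u)%:R * chain_sum f M r j) u j =
  'C(r.+1, u)%:R * chain_sum f M r.+1 j.
Proof.
rewrite chain_sumS /random_step /occupy.
have E v c : v.+1%:R * ('C(r, v.+1)%:R * c) =
    (r%:R - v%:R) * ('C(r, v)%:R * c) :> {poly rat}.
  have [ltrv|levr] := ltnP r v; first by rewrite !bin_small ?mul0r ?mulr0 // ltnW.
  by rewrite !mulrA -natrB // -!natrM mul_bin_left.
case: u => [|u]; first by rewrite (E 0%N) !bin0; ring.
by rewrite (E u.+1) (E u) binS; ring.
Qed.

Lemma random_step_mean K (h : nat -> nat -> nat -> {poly rat}) u j :
  random_step (fun u j => binomial_mean K (fun r => h r u j)) u j =
  binomial_mean K (fun r => random_step (h r) u j).
Proof.
have occupyE a u' j' :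
    occupy (fun u j => binomial_mean K (fun r => h r u j)) a u' j' =
    binomial_mean K (fun r => occupy (h r) a u' j').
  by rewrite /occupy -!binomial_meanZ -!binomial_meanD.
rewrite /random_step occupyE; case: u => [|u].
  by rewrite addr0; apply: eq_binomial_mean => r _; rewrite addr0.
by rewrite occupyE -binomial_meanD.
Qed.

Lemma eq_random_step g g' u j : (forall u j, g u j = g' u j) ->
  random_step g u j = random_step g' u j.
Proof. by move=> eqg; rewrite /random_step /occupy; case: u => *; rewrite !eqg. Qed.

(** Each passenger either keeps [r] with weight [1 - 'X] or applies E once more with weight ['X], as
    in [binomial_mean]. *)
Lemma prefix_sumE N M K u j : (N < M)%N ->
  prefix_sum N K u j =
  binomial_mean K (fun r => 'C(r, u)%:R * chain_sum (tail_sum N) M r j).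
Proof.
move=> ltNM; elim: K u j => [|K IHK] u j.
  rewrite /= chain_sum0 bin0n /prefix_sum /= -/(tail_sum N j).
  case: eqP => _; last by rewrite mul0r.
  rewrite mul1r; case: ltnP => // leMj; rewrite /tail_sum sum_bits_gt //.
  exact: leq_trans leMj.
rewrite prefix_sum_rec IHK (eq_random_step _ _ _ _ IHK) random_step_mean.
congr (_ + _ * _); apply: eq_binomial_mean => r _.
exact: random_step_chain.
Qed.

(** * Extraction of the coefficient *)

Theorem theorem2 (n k m : nat) (hk : (0 < k)%N) (hkn : (k <= n)%N) :
  P_misseated n k m =
  (n`!)%:R^-1 *
  (\sum_(0 <= s < k.+1)
     'C(k, s) *
     \sum_(0 <= t < s.+1)
        (t`!) ^ 2 *
        (if (s <= m)%N
         then stirling2 (m - s) t * stirling1 (n - k + 1) (m - s + 1)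
         else 0) *
        \sum_(t <= r < s.+1) 'C(s, r) * lah r t * derange (s - r))%N%:R.
Proof.
apply: (mulfI (x := n`!%:R)); first by rewrite pnatr_eq0 -lt0n fact_gt0.
rewrite mulrA mulfV ?mul1r; last by rewrite pnatr_eq0 -lt0n fact_gt0.
rewrite /P_misseated board_boardp ?subnn // subn0 expr0 mul1r.
(* In the empty plane all flags are false, and only one list has no true flag. *)
transitivity ((prefix_sum (n - k) k 0 0)`_m).
  have sum_bits0 N F : sum_bits N 0 F = F (nseq N false).
    by elim: N F => [|N IHN] F //=; rewrite IHN addr0.
  rewrite /prefix_sum !sum_bits0 -nseqD subnKC //.
  congr ((polyseq (boardp _ _ _))`_m).
  by apply: (@eq_from_nth _ false); rewrite ?size_map ?size_iota ?size_nseq // => i ltin;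
    rewrite (nth_map 0%N) ?size_iota // nth_nseq ltin.
rewrite (@prefix_sumE _ n.+1) ?ltnS ?leq_subr //.
pose f := tail_sum (n - k).
(* Expanding [r! 'C(r, t)] in the ['C(r, s)] makes the mean explicit. *)
have -> : binomial_mean k (fun r => 'C(r, 0)%:R * chain_sum f n.+1 r 0) =
    \sum_(s < k.+1) 'C(k, s)%:R * 'X^s * \sum_(t < n.+1) (moved_injections s t)%:R * f t.
  transitivity (binomial_mean k (fun r =>
      \sum_(s < k.+1) (\sum_(t < n.+1) (moved_injections s t)%:R * f t) * 'C(r, s)%:R)).
    apply: eq_binomial_mean => r lerk; rewrite bin0 mul1r /chain_sum.
    under [RHS]eq_bigr => s _ do rewrite big_distrl.
    rewrite exchange_big big_distrr; apply: eq_bigr => t _ /=.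
    rewrite bin0 mul1n addn0 mulrA -natrM -sum_bin_moved_injections natr_sum big_distrl.
    rewrite (big_ord_widen k.+1 (fun s => ('C(r, s) * moved_injections s t)%:R * f t)) //.
    rewrite big_mkcond; apply: eq_bigr => s _; rewrite natrM.
    case: ltnP => [_|ltrs]; first ring.
    by rewrite bin_small // mulr0.
  rewrite (binomial_mean_sum k k.+1
    (fun s r => (\sum_(t < n.+1) (moved_injections s t)%:R * f t) * 'C(r, s)%:R)).
  apply: eq_bigr => s _.
  by rewrite binomial_meanZ binomial_mean_bin mulrC.
rewrite coef_sum big_mkord natr_sum; apply: eq_bigr => s _.
rewrite -mulrA mulr_natl coefMn natrM mulr_natl; congr (_ *+ _).
rewrite coefXnM big_mkord; case: ltnP => [_|lesm].
  by rewrite big1 // => t _; rewrite muln0.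
rewrite coef_sum (big_ord_widen n.+1 (fun t => t`! ^ 2 *
   (stirling2 (m - s) t * stirling1 (n - k + 1) (m - s + 1)) *
   \sum_(t <= r < s.+1) 'C(s, r) * lah r t * derange (s - r))%N); last first.
  by rewrite ltnS (leq_trans (leq_ord s)).
rewrite [in RHS]big_mkcond natr_sum; apply: eq_bigr => t _.
rewrite mulr_natl coefMn coef_tail_sum -mulrnA; congr (_%:R).
(* Terms with [r < t] vanish because [lah r t = 0], hence so does everything with [t > s]. *)
rewrite /moved_injections !addn1; case: ltnP => [lets|ltst].
  have -> : (\sum_(t <= r < s.+1) 'C(s, r) * lah r t * derange (s - r) =
     \sum_(r < s.+1) 'C(s, r) * lah r t * derange (s - r))%N; last first.
    by rewrite -mulnn; ring.
  rewrite big_geq_mkord big_mkcond; apply: eq_bigr => r _.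
  by case: leqP => // ltrt; rewrite lah_small ?muln0.
rewrite big1 ?muln0 // => r _; rewrite lah_small ?muln0 //.
exact: leq_trans (ltn_ord r) ltst.
Qed.
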